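(* Let $p$ be a prime. Then there exist exactly $\lvert\{t\in\mathbb{N}\mid t\text{ divides }p-1\}\rvert+5$ different linearly closed iterative algebras on $\mathbb{Z}_p$.
   Context: $\mathbb{N}=\{1,2,3,\dots\}$. All operations considered have arity $n\ge1$. For sets $E,F$ of finitary operations on $\mathbb{Z}_p$, $EF:=\{f(g_1,\dots,g_n)\mid n,m\in\mathbb{N},\ f\in E \text{ } n\text{-ary},\ g_1,\dots,g_n\in F\text{ } m\text{-ary}\}$. $\mathcal{L}_{\mathbb{Z}_p}$ is the clone on $\mathbb{Z}_p$ generated by $+$, and $J_{\mathbb{Z}_p}$ is the set of all projections $\pi^n_j(x_1,\dots,x_n)=x_j$, $1\le j\le n$. A nonempty set $C$ of finitary operations on $\mathbb{Z}_p$ is a linearly closed clonoid on $\mathbb{Z}_p$ if $\mathcal{L}_{\mathbb{Z}_p}C\subseteq C$ and $C\mathcal{L}_{\mathbb{Z}_p}\subseteq C$. It is a linearly closed iterative algebra on $\mathbb{Z}_p$ if moreover $C(C\cup J_{\mathbb{Z}_p})\subseteq C$. *)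

(* Defs.v *)
From mathcomp Require Import all_boot all_order all_algebra.
From mathcomp Require Import boolp classical_sets functions cardinality.

Set Implicit Arguments.
Unset Strict Implicit.
Unset Printing Implicit Defensive.

Local Open Scope classical_set_scope.
Local Open Scope ring_scope.

(* The field Z/pZ is ['F_p]; this is the intended object only when p is prime. *)

Definition op (p n : nat) := 'rV['F_p]_n -> 'F_p.

(* Operations have arity at least 1: [FinOp f] records the arity of f as
   n.+1.  A set of finitary operations is an element of [set (finop p)]. *)
Record finop (p : nat) := FinOp { arity_pred : nat; fun_of : op p arity_pred.+1 }.

Arguments FinOp {p n} f : rename.

Definition compose (p n m : nat) (f : op p n) (g : 'I_n -> op p m) : op p m :=
  fun x => f (\row_i g i x).

Definition proj (p n : nat) (j : 'I_n) : op p n := fun x => x ord0 j.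

Definition add_op (p : nat) : op p 2 := fun x => x ord0 ord0 + x ord0 ord_max.

(* The product EF. *)
Definition setcomp (p : nat) (E F : set (finop p)) : set (finop p) :=
  [set h | exists (n m : nat) (f : op p n.+1) (g : 'I_n.+1 -> op p m.+1),
     [/\ E (FinOp f), (forall i, F (FinOp (g i))) & h = FinOp (compose f g)]].

Definition projections (p : nat) : set (finop p) :=
  [set h | exists (n : nat) (j : 'I_n.+1), h = FinOp (@proj p n.+1 j)].

Arguments projections : clear implicits.

Definition is_clone (p : nat) (C : set (finop p)) : Prop :=
  projections p `<=` C /\ setcomp C C `<=` C.

(* The clone on Z/pZ generated by +. *)
Definition lin_clone (p : nat) : set (finop p) :=
  smallest (@is_clone p) [set FinOp (@add_op p)].

Arguments lin_clone : clear implicits.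

Definition linearly_closed_clonoid (p : nat) (C : set (finop p)) : Prop :=
  [/\ C !=set0, setcomp (lin_clone p) C `<=` C & setcomp C (lin_clone p) `<=` C].

Definition linearly_closed_iterative_algebra (p : nat) (C : set (finop p)) : Prop :=
  linearly_closed_clonoid C /\ setcomp C (C `|` projections p) `<=` C.

(* Main.v *)
Require Import Defs.
From mathcomp Require Import all_boot all_order all_algebra.
From mathcomp Require Import boolp classical_sets functions cardinality.
From mathcomp Require Import all_fingroup all_solvable ring.

Local Open Scope classical_set_scope.
Local Open Scope card_scope.

Set Implicit Arguments.
Unset Strict Implicit.
Unset Printing Implicit Defensive.

Import GRing.Theory.

(** Write F for the field with p elements and L for the clone generated by +,
whose members are the additive operations (those of the form
sum_i c_i x_i).  The algebras are: the zero operations, the constant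
operations, L, the affine operations, all operations, and, for each divisor t
of p - 1, the operations f with f(0) = 0 and f(ax) = a f(x) for all a with
a^t = 1.

That nothing else occurs rests on two observations about a linearly closed
iterative algebra C.

If C contains a non-constant operation, then it contains the identity, hence
all of L ([algebra_additive]).  For every d <> 0 it has a unary r with r(0) = 0
and r(d) = d; if g in C fixes some points but moves a, take d = a - g(a): the
operation g(x) + r(x - g(x)) lies in C, fixes what g fixes, and fixes a.  This
is the step where the iterative condition is used: r(x - g(x)) mixes an
argument from C with a projection.

If C contains L and a non-affine operation, then its second difference gives a
binary q in C that vanishes on both axes and not at (1, 1).  Such a q merges
two operations vanishing at different points into one vanishing at both, so an
operation belongs to C as soon as it can be matched by members of C at any two
points ([algebra_interpolation]).  In the presence of a nonzero constant affine
operations already match everything at two points, so C is everything.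
Otherwise all members of C fix 0, and the only obstruction comes from points
v, cv for which every h in C satisfies h(cx) = c h(x).  The nonzero c with this
property form a subgroup of the cyclic group of units of F, that is, the
solutions of c^t = 1 for some t dividing p - 1.

The algebras listed are pairwise different: membership of the constant 1, of
the identity and of x y^(p-1) separates all but the last family, inside which
x^(t+1) recovers t. *)
Section Algebras.
Local Open Scope ring_scope.

(** * Subgroups of the units of a finite field *)

(** The units are cyclic, so a subgroup is determined by its order t; by
Lagrange its elements solve a^t = 1, and conversely a solution generates a
subgroup of order dividing t. *)
Lemma subgroup_unit_roots (K : finFieldType) (A : K -> Prop) :
  A 1 -> (forall a b, A a -> A b -> A (a * b)) ->
  exists2 t, (t %| #|K|.-1)%N & forall a, a != 0 -> A a <-> a ^+ t = 1.
Proof.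
move=> A1 AM; pose H : {set {unit K}} := finset (fun u => `[< A (val u) >]).
have gH : group_set H.
  apply/group_setP; split=> [|u w]; rewrite !inE.
    by apply/asboolP; rewrite FinRing.val_unit1.
  by move=> /asboolP Au /asboolP Aw; apply/asboolP/AM.
pose G := group gH.
exists #|G|; first by rewrite -card_finField_unit cardSg ?finset.subsetT.
move=> a a0; have ua : a \is a GRing.unit by rewrite unitfE.
pose u : {unit K} := FinRing.unit K ua.
have -> : A a <-> u \in G.
  by rewrite inE; split=> [Aa|/asboolP//]; exact/asboolP.
have -> : a ^+ #|G| = 1 <-> (u ^+ #|G| = 1)%g.
  by rewrite -[a]/(val u) -FinRing.val_unitX; split=> [e|->//]; exact/val_inj.
split=> [/expg_cardG //|/eqP]; rewrite -order_dvdn -cycle_subG /order.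
have cycK := field_unit_group_cyclic [set: {unit K}]%G.
by rewrite (cardSg_cyclic cycK) ?finset.subsetT.
Qed.

Lemma exists_element_of_order (K : finFieldType) t : (t %| #|K|.-1)%N ->
  exists a : K, forall k, a ^+ k = 1 <-> (t %| k)%N.
Proof.
have /cyclicP[x xE] := field_unit_group_cyclic [set: {unit K}]%G.
rewrite -card_finField_unit xE -/(order x) => tx.
have [y yt] : exists y : {unit K}, #[y]%g = t.
  exists (x ^+ (#[x] %/ t))%g.
  by rewrite orderXdiv ?dvdn_div // divnA // mulKn.
exists (val y) => k; rewrite -FinRing.val_unitX -yt order_dvdn.
by split=> [yk1|/eqP->//]; apply/eqP/val_inj.
Qed.

(** * The clone generated by addition *)

Variable p : nat.
Local Notation F := 'F_p.

(** Sets of operations are described by a property P uniform in the arity, so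
that membership of [FinOp f] is [P _ f] by computation. *)
Definition ops_with (P : forall n, op p n -> Prop) : set (finop p) :=
  [set h | P _ (@fun_of p h)].

Definition additive_op n (f : op p n) := forall x y, f (x + y) = f x + f y.

Lemma additive_op0 n (f : op p n) : additive_op f -> f 0 = 0.
Proof. by move=> fD; apply: (addIr (f 0)); rewrite -fD !add0r. Qed.

(** Every scalar of a prime field is a multiple of 1, so additivity entails
homogeneity. *)
Lemma additive_opZ n (f : op p n) (a : F) x :
  additive_op f -> f (a *: x) = a * f x.
Proof.
move=> fD; rewrite -[a]natr_Zp mulr_natl scaler_nat.
elim: (nat_of_ord a) => [|k IHk]; first by rewrite !mulr0n additive_op0.
by rewrite !mulrS fD IHk.
Qed.

Lemma additive_op_sum n (f : op p n) (I : Type) (r : seq I)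
    (x : I -> 'rV[F]_n) :
  additive_op f -> f (\sum_(i <- r) x i) = \sum_(i <- r) f (x i).
Proof.
by move=> fD; apply: (big_morph f) => [u v|]; [exact: fD|exact: additive_op0].
Qed.

Lemma additive_opE n (f : op p n) x :
  additive_op f -> f x = \sum_i x ord0 i * f (delta_mx 0 i).
Proof.
move=> fD; rewrite {1}[x]row_sum_delta additive_op_sum //.
by apply: eq_bigr => i _; rewrite additive_opZ.
Qed.

Lemma additive_comp n m (f : op p n) (g : 'I_n -> op p m) :
  additive_op f -> (forall i, additive_op (g i)) -> additive_op (compose f g).
Proof.
move=> fD gD x y; rewrite /compose -fD; congr f.
by apply/rowP => i; rewrite !mxE gD.
Qed.

Lemma additive_proj n (j : 'I_n) : additive_op (@proj p n j).
Proof. by move=> x y; rewrite /proj mxE. Qed.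

Lemma additive_clone :
  is_clone (ops_with additive_op).
Proof.
split=> [_ [n [j ->]]|_ [n [m [f [g [fD gD ->]]]]]] /=.
  exact: additive_proj.
exact: additive_comp.
Qed.

Lemma additive_add_op : additive_op (@add_op p).
Proof. by move=> x y; rewrite /add_op !mxE addrACA. Qed.

Lemma lin_clone_additive n (f : op p n.+1) :
  lin_clone p (FinOp f) -> additive_op f.
Proof.
move=> Lf; apply: (Lf (ops_with additive_op)).
split; first exact: additive_clone.
by move=> _ -> /=; exact: additive_add_op.
Qed.

Lemma clone_add (C : set (finop p)) n (f g : op p n.+1) : is_clone C ->
  C (FinOp (@add_op p)) -> C (FinOp f) -> C (FinOp g) ->
  C (FinOp (fun x => f x + g x)).
Proof.
move=> [_ CC] Cadd Cf Cg; apply: CC.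
exists 1, n, (@add_op p), (fun i => if i == ord0 then f else g); split=> //.
  by move=> i; case: ifP.
by congr FinOp; apply/funext => x; rewrite /compose /add_op !mxE.
Qed.

(** An additive operation is a sum of operations c x_j, and each of these is a
repeated sum x_j + ... + x_j; for c = 0, where no summand is available, the
sum has as many terms as F has elements. *)
Lemma additive_lin_clone n (f : op p n.+1) :
  additive_op f -> lin_clone p (FinOp f).
Proof.
move=> fD C [cloneC addC].
have Cadd : C (FinOp (@add_op p)) by exact: addC.
have Cproj j : C (FinOp (@proj p n.+1 j)) by apply: cloneC.1; exists n, j.
have CM k j : C (FinOp (fun x : 'rV[F]_n.+1 => k.+1%:R * x ord0 j)).
  elim: k => [|k IHk].
    rewrite (_ : (fun _ => _) = @proj p n.+1 j) //.
    by apply/funext => x; rewrite mul1r.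
  rewrite (_ : (fun _ => _) =
    fun x : 'rV[F]_n.+1 => (@proj p n.+1 j) x + (k.+1%:R * x ord0 j)).
    exact: clone_add.
  by apply/funext => x; rewrite [k.+2%:R]mulrS mulrDl mul1r.
have {}CM (a : F) j : C (FinOp (fun x : 'rV[F]_n.+1 => a * x ord0 j)).
  rewrite -[a]natr_Zp; case: (nat_of_ord a) => [|k]; last exact: CM.
  have -> : 0%:R = (Zp_trunc (pdiv p)).+2%:R :> F
    by exact: esym (@pchar_Zp (Zp_trunc (pdiv p)).+2 isT).
  exact: CM.
have Csum (r : seq 'I_n.+1) (a : 'I_n.+1 -> F) :
    C (FinOp (fun x : 'rV[F]_n.+1 => \sum_(j <- r) x ord0 j * a j)).
  elim: r => [|j r IHr].
    rewrite (_ : (fun _ => _) = fun x : 'rV[F]_n.+1 => 0 * x ord0 ord0) //.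
    by apply/funext => x; rewrite big_nil mul0r.
  rewrite (_ : (fun _ => _) = fun x : 'rV[F]_n.+1 =>
    (a j * x ord0 j) + \sum_(j <- r) x ord0 j * a j); first exact: clone_add.
  by apply/funext => x; rewrite big_cons mulrC.
rewrite (_ : f = fun x => \sum_j x ord0 j * f (delta_mx 0 j)).
  exact: Csum.
by apply/funext => x; exact: additive_opE.
Qed.

(** * The algebras of the list *)

Lemma ops_with_clone (P : forall n, op p n -> Prop) :
  (forall n (f : op p n), additive_op f -> P n f) ->
  (forall n m (f : op p n) (g : 'I_n -> op p m),
     P n f -> (forall i, P m (g i)) -> P m (compose f g)) ->
  linearly_closed_iterative_algebra (ops_with P).
Proof.
move=> Padd Pcomp.
have linP : lin_clone p `<=` ops_with P.
  by case=> n f /lin_clone_additive /Padd.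
have projP : projections p `<=` ops_with P.
  by move=> _ [n [j ->]]; apply: Padd; exact: additive_proj.
have compP : setcomp (ops_with P) (ops_with P) `<=` ops_with P.
  by move=> _ [n [m [f [g [Pf Pg ->]]]]]; exact: Pcomp.
have setcompS A B : A `<=` ops_with P -> B `<=` ops_with P ->
    setcomp A B `<=` ops_with P.
  move=> AP BP _ [n [m [f [g [Af Bg ->]]]]].
  apply: Pcomp; first exact: (AP (FinOp f)).
  by move=> i; exact: (BP (FinOp (g i))).
split; [split|]; try exact: setcompS.
- by exists (FinOp (@proj p 1 ord0)); apply: projP; exists 0%N, ord0.
- by apply: setcompS => // h [|/projP].
Qed.

(** The zero and the constant operations are not clones, as they contain no
projection, but composing on the right with anything preserves them. *)
Lemma ops_with_absorbing (P : forall n, op p n -> Prop) :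
  P 1 (fun=> 0) ->
  (forall n m (f : op p n) (g : 'I_n -> op p m), P n f -> P m (compose f g)) ->
  (forall n m (f : op p n) (g : 'I_n -> op p m),
     additive_op f -> (forall i, P m (g i)) -> P m (compose f g)) ->
  linearly_closed_iterative_algebra (ops_with P).
Proof.
move=> P0 Pabs Plin.
split; [split|].
- by exists (FinOp ((fun=> 0) : op p 1)).
- move=> _ [n [m [f [g [/lin_clone_additive Lf Pg ->]]]]]; exact: Plin.
- by move=> _ [n [m [f [g [Pf _ ->]]]]]; exact: Pabs.
- by move=> _ [n [m [f [g [Pf _ ->]]]]]; exact: Pabs.
Qed.

Definition zero_op n (f : op p n) := forall x, f x = 0.
Definition constant_op n (f : op p n) := forall x, f x = f 0.
Definition affine_op n (f : op p n) := additive_op (fun x => f x - f 0).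
Definition any_op n (f : op p n) := True.
Definition homogeneous_op t n (f : op p n) :=
  f 0 = 0 /\ forall (a : F) x, a ^+ t = 1 -> f (a *: x) = a * f x.

Lemma compose0 n m (f : op p n) (g : 'I_n -> op p m) :
  (forall i, g i 0 = 0) -> compose f g 0 = f 0.
Proof. by move=> g0; congr f; apply/rowP => i; rewrite !mxE g0. Qed.

Lemma zero_algebra : linearly_closed_iterative_algebra (ops_with zero_op).
Proof.
apply: ops_with_absorbing => // [n m f g f0 x|n m f g fD g0 x].
  exact: f0.
rewrite /compose (_ : \row_i g i x = 0) ?additive_op0 //.
by apply/rowP => i; rewrite !mxE g0.
Qed.

Lemma constant_algebra :
  linearly_closed_iterative_algebra (ops_with constant_op).
Proof.
apply: ops_with_absorbing => // [n m f g fC x|n m f g _ gC x].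
  by rewrite /compose fC [RHS]fC.
by congr f; apply/rowP => i; rewrite !mxE gC.
Qed.

Lemma additive_algebra :
  linearly_closed_iterative_algebra (ops_with additive_op).
Proof. by apply: ops_with_clone => // n m f g; exact: additive_comp. Qed.

Lemma affine_algebra : linearly_closed_iterative_algebra (ops_with affine_op).
Proof.
apply: ops_with_clone => [n f fD x y|n m f g fA gA x y].
  by rewrite additive_op0 // !subr0.
have gE z : \row_i g i z = \row_i (g i z - g i 0) + \row_i g i 0.
  by apply/rowP => i; rewrite !mxE subrK.
have fE u v : f (u + v) - f v = f u - f 0.
  have e := fA u v; rewrite /= in e.
  by apply: (addIr (f v - f 0)); rewrite -e addrA subrK.
rewrite /compose !(gE (_ + _)) !(gE x) !(gE y) !fE -fA; congr (f _ - _).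
by apply/rowP => i; rewrite !mxE; exact: gA.
Qed.

Lemma full_algebra : linearly_closed_iterative_algebra (ops_with any_op).
Proof. exact: ops_with_clone. Qed.

Lemma homogeneous_algebra t :
  linearly_closed_iterative_algebra (ops_with (homogeneous_op t)).
Proof.
apply: ops_with_clone => [n f fD|n m f g [f0 fH] gH].
  by split=> [|a x _]; [exact: additive_op0|exact: additive_opZ].
split=> [|a x a1]; first by rewrite compose0 // => i; case: (gH i).
rewrite /compose -fH //; congr f; apply/rowP => i; rewrite !mxE.
by case: (gH i) => _ ->.
Qed.

(** * Closure properties and the identity *)

Section Closure.
Variable C : set (finop p).
Hypothesis algC : linearly_closed_iterative_algebra C.

Lemma algebra_lin n m (l : op p n.+1) (g : 'I_n.+1 -> op p m.+1) :
  additive_op l -> (forall i, C (FinOp (g i))) -> C (FinOp (compose l g)).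
Proof.
move=> /additive_lin_clone Ll Cg; case: algC => -[_ LC _] _; apply: LC.
by exists n, m, l, g.
Qed.

Lemma algebra_add n (f g : op p n.+1) :
  C (FinOp f) -> C (FinOp g) -> C (FinOp (fun x => f x + g x)).
Proof.
move=> Cf Cg; rewrite (_ : (fun _ => _) =
  compose (@add_op p) (fun i : 'I_2 => if i == ord0 then f else g)).
  by apply: algebra_lin => [|i]; [exact: additive_add_op|case: ifP].
by apply/funext => x; rewrite /compose /add_op !mxE.
Qed.

Lemma algebra_scale n (c : F) (f : op p n.+1) :
  C (FinOp f) -> C (FinOp (fun x => c * f x)).
Proof.
move=> Cf; rewrite (_ : (fun _ => _) =
  compose (fun y : 'rV[F]_1 => c * y ord0 ord0) (fun i : 'I_1 => f)).
  by apply: algebra_lin => // x y; rewrite mxE mulrDr.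
by apply/funext => x; rewrite /compose mxE.
Qed.

Lemma algebra_sub n (f g : op p n.+1) :
  C (FinOp f) -> C (FinOp g) -> C (FinOp (fun x => f x - g x)).
Proof.
move=> Cf Cg; have /(algebra_add Cf) := algebra_scale (-1) Cg.
by under [X in FinOp X]funext do rewrite mulN1r.
Qed.

Lemma algebra_mulmx n m (f : op p n.+1) (A : 'M[F]_(m.+1, n.+1)) :
  C (FinOp f) -> C (FinOp (fun x => f (x *m A))).
Proof.
move=> Cf; case: algC => -[_ _ CL] _; apply: CL.
exists n, m, f, (fun i x => (x *m A) ord0 i); split=> // [i|].
  by apply: additive_lin_clone => x y; rewrite mulmxDl mxE.
by congr FinOp; apply/funext => x; congr f; apply/rowP => i; rewrite mxE.
Qed.

Lemma algebra_at0 n (f : op p n.+1) m :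
  C (FinOp f) -> C (FinOp ((fun=> f 0) : op p m.+1)).
Proof.
move=> /(algebra_mulmx (0 : 'M[F]_(m.+1, n.+1))).
by under [X in FinOp X]funext do rewrite mulmx0.
Qed.

(** Restrict f to the line through 0 and v, shift its value at 0 to 0, and
rescale both sides. *)
Lemma algebra_unary_moving n (f : op p n.+1) v (d : F) :
  C (FinOp f) -> f v != f 0 -> d != 0 ->
  exists r : op p 1, [/\ C (FinOp r), r 0 = 0 & r d%:M = d].
Proof.
move=> Cf fv d0.
exists (fun y => d / (f v - f 0) * (f (y *m (d^-1 *: v)) - f 0)); split.
- by apply/algebra_scale/algebra_sub; [exact: algebra_mulmx|exact: algebra_at0].
- by rewrite mul0mx subrr mulr0.
- by rewrite mul_scalar_mx scalerA divff // scale1r divfK // subr_eq0.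
Qed.

(** If g fixes s but not a, and r(0) = 0, r(d) = d for d = a - g(a), then
g(x) + r(x - g(x)) fixes s and a.  Applied to all points of F, this yields the
identity. *)
Lemma algebra_fix_points n (f : op p n.+1) v (s : seq F) :
  C (FinOp f) -> f v != f 0 ->
  exists2 g : op p 1, C (FinOp g) & forall a, a \in s -> g a%:M = a.
Proof.
move=> Cf fv; elim: s => [|a s [g Cg gs]].
  by exists (fun=> 0 * f 0) => //; apply/algebra_scale/algebra_at0.
have [ga|ga] := eqVneq (g a%:M) a.
  by exists g => // b; rewrite in_cons => /predU1P[->|/gs].
have [|r [Cr r0 ra]] := @algebra_unary_moving n f v (a - g a%:M) Cf fv.
  by rewrite subr_eq0 eq_sym.
exists (fun y => g y + r (y - (g y)%:M)) => [|b]; last first.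
  rewrite in_cons -raddfB /= => /predU1P[->|/gs ->].
    by rewrite ra addrC subrK.
  by rewrite subrr raddf0 r0 addr0.
apply: algebra_add => //.
(* r(x - y) is r after a linear map; y is then replaced by g(x) while the
   projection x stays, which the iterative condition allows. *)
pose M : 'M[F]_(2, 1) := \matrix_(i, j) (if i == ord0 then 1 else - 1).
case: algC => _; apply.
exists 1%N, 0%N, (fun x => r (x *m M)).
exists (fun i => if i == ord0 then @proj p 1 ord0 else g); split.
- exact: algebra_mulmx.
- by move=> i; case: ifP => _; [right; exists 0%N, ord0|left].
congr FinOp; apply/funext => y; congr r; apply/rowP => j.
rewrite !mxE !big_ord_recl big_ord0 !mxE /= /proj (ord1 j) eqxx mulr1n.
by rewrite mulr1 mulrN1 addr0.
Qed.

Lemma algebra_additive n (f : op p n.+1) v m (l : op p m.+1) :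
  C (FinOp f) -> f v != f 0 -> additive_op l -> C (FinOp l).
Proof.
move=> Cf fv lD.
have [g Cg gE] := algebra_fix_points (enum F) Cf fv.
have -> : l = compose l (fun j x => g (x *m (delta_mx j 0))).
  apply/funext => x; congr l; apply/rowP => j; rewrite mxE -colE.
  by rewrite [col j x]mx11_scalar gE ?mem_enum // mxE.
by apply: algebra_lin => // j; exact: algebra_mulmx.
Qed.

(** * Two-point interpolation *)

Lemma algebra_comp n m (f : op p n.+1) (g : 'I_n.+1 -> op p m.+1) :
  C (FinOp f) -> (forall i, C (FinOp (g i))) -> C (FinOp (compose f g)).
Proof.
move=> Cf Cg; case: algC => _; apply; exists n, m, f, g; split=> // i.
by left.
Qed.

Definition row2 (a b : F) : 'rV[F]_2 := \row_i (if i == ord0 then a else b).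

(** Regarding nonzero as true, q behaves on 0 and 1 as the conjunction and is
false whenever one argument is 0. *)
Definition is_conjunction (q : op p 2) :=
  [/\ forall a, q (row2 a 0) = 0, forall b, q (row2 0 b) = 0
    & q (row2 1 1) != 0].

(** With f(x + y) - f(0) different from (f(x) - f(0)) + (f(y) - f(0)), take
for q the corresponding difference for the vectors ax and by, as a function
of the scalars a and b. *)
Lemma algebra_conjunction n (f : op p n.+1) :
  C (FinOp f) -> ~ affine_op f ->
  exists2 q : op p 2, C (FinOp q) & is_conjunction q.
Proof.
move=> Cf /existsNP[x /existsNP[y /eqP fxy]].
pose M (u w : 'rV[F]_n.+1) : 'M[F]_(2, n.+1) :=
  \matrix_(i, j) (if i == ord0 then u else w) ord0 j.
have rowM a b u w : row2 a b *m M u w = a *: u + b *: w.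
  by apply/rowP => j; rewrite !mxE !big_ord_recl big_ord0 !mxE /= addr0.
exists (fun z => (f (z *m M x y) - f 0) -
  ((f (z *m M x 0) - f 0) + (f (z *m M 0 y) - f 0))).
  do ![apply: algebra_sub => //|apply: algebra_add => //];
    by [exact: algebra_mulmx|exact: algebra_at0].
by split=> [a|b|]; rewrite !rowM ?scale1r ?scaler0 ?scale0r ?addr0 ?add0r;
  rewrite ?subrr ?addr0 ?add0r ?subrr // subr_eq0.
Qed.

Section Interpolation.
Variable q : op p 2.
Hypotheses (Cq : C (FinOp q)) (qP : is_conjunction q).

(** If h vanishes on s, k at w and both are nonzero at v, then
q(h / h(v), k / k(v)) vanishes on s and at w but not at v. *)
Lemma algebra_vanishing n (v : 'rV[F]_n.+1) (s : seq 'rV[F]_n.+1) :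
  (exists2 h : op p n.+1, C (FinOp h) & h v != 0) ->
  (forall w, w \in s ->
     exists h : op p n.+1, [/\ C (FinOp h), h v != 0 & h w = 0]) ->
  exists h : op p n.+1,
    [/\ C (FinOp h), h v != 0 & forall w, w \in s -> h w = 0].
Proof.
move=> [h0 Ch0 h0v]; elim: s => [|w s IHs] sepP; first by exists h0.
have [u us|h [Ch hv hs]] := IHs; first by apply: sepP; rewrite in_cons us orbT.
have [k [Ck kv kw]] := sepP w (mem_head w s).
case: qP => qx0 q0y q11.
pose a := (h v)^-1; pose b := (k v)^-1.
exists (compose q (fun i x => if i == ord0 then a * h x else b * k x)).
have qE x : compose q (fun i x => if i == ord0 then a * h x else b * k x) x =
    q (row2 (a * h x) (b * k x)).
  by congr q; apply/rowP => i; rewrite !mxE; case: ifP.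
split.
- apply: algebra_comp => // i.
  by case: (i == ord0); exact: algebra_scale.
- by rewrite qE /a /b !mulVf.
- move=> u; rewrite qE in_cons => /predU1P[->|/hs ->].
    by rewrite kw mulr0 qx0.
  by rewrite mulr0 q0y.
Qed.

(** An operation g in C that agrees with f on s is corrected at a further
point v by a multiple of some k in C vanishing on s but not at v.  By
[algebra_vanishing] such a k only has to be found for one point w of s at a
time, where h - g does it, h being a match of f at v and w. *)
Lemma algebra_interpolation n (f : op p n.+1) :
  (forall v w, exists h : op p n.+1,
     [/\ C (FinOp h), h v = f v & h w = f w]) ->
  C (FinOp f).
Proof.
move=> fP.
have [g Cg gE] : exists2 g : op p n.+1, C (FinOp g) &
    forall w, w \in enum 'rV[F]_n.+1 -> g w = f w.
  elim: (enum _) => [|v s [g Cg gs]].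
    by have [h [Ch _ _]] := fP 0 0; exists h.
  have [gv|gv] := eqVneq (g v) (f v).
    by exists g => // w; rewrite in_cons => /predU1P[->|/gs].
  have sepP w : w \in s ->
      exists h : op p n.+1, [/\ C (FinOp h), h v != 0 & h w = 0].
    move=> /gs gw; have [h [Ch hv hw]] := fP v w.
    exists (fun x => h x - g x); split; first exact: algebra_sub.
      by rewrite hv subr_eq0 eq_sym.
    by rewrite hw gw subrr.
  have [|k [Ck kv ks]] := algebra_vanishing _ sepP.
    have [h [Ch hv _]] := fP v v; exists (fun x => h x - g x).
      exact: algebra_sub.
    by rewrite hv subr_eq0 eq_sym.
  exists (fun x => g x + (f v - g v) / k v * k x).
    by apply: algebra_add => //; exact: algebra_scale.
  move=> w; rewrite in_cons => /predU1P[->|ws].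
    by rewrite divfK // addrC subrK.
  by rewrite /= (ks w ws) mulr0 addr0 gs.
suff -> : f = g by [].
by apply/funext => x; rewrite gE ?mem_enum.
Qed.

End Interpolation.

Hypothesis linC : forall n (l : op p n.+1), additive_op l -> C (FinOp l).

Lemma algebra_full n (f : op p n.+1) m (g : op p m.+1) k (c : op p k.+1) :
  C (FinOp g) -> ~ affine_op g -> C (FinOp c) -> c 0 != 0 -> C (FinOp f).
Proof.
move=> Cg gNaff Cc c0.
have [q Cq qP] := algebra_conjunction Cg gNaff.
have cstC (a : F) : C (FinOp ((fun=> a) : op p n.+1)).
  have /(algebra_scale (a / c 0)) := algebra_at0 n Cc.
  by under [X in FinOp X]funext do rewrite divfK //.
apply: (algebra_interpolation Cq qP) => v w.
have [->|vw] := eqVneq v w; first by exists (fun=> f w).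
have /rV0Pn[i] : w - v != 0 by rewrite subr_eq0 eq_sym.
rewrite !mxE => wvi.
exists (fun x =>
  (f w - f v) / (w ord0 i - v ord0 i) * (x ord0 i - v ord0 i) + f v).
split.
- by apply: algebra_add => //; apply/algebra_scale/algebra_sub => //;
    apply: linC => x y; rewrite mxE.
- by rewrite subrr mulr0 add0r.
- by rewrite divfK // subrK.
Qed.

(** The automorphisms x |-> a x of (F, C), together with
a = 0 when all members of C fix 0. *)
Definition multipliers : set F :=
  [set a | forall n (f : op p n.+1), C (FinOp f) ->
    forall x, f (a *: x) = a * f x].

(** By two-point interpolation only pairs v, w matter.  If w is not a multiple
of v, linear forms match f.  If w = cv with c a multiplier, a linear form
matching f at v also does at w.  If c is not a multiplier, some unary u in C
has u(c) <> c u(1), so the identity and u span all pairs of values at 1, c. *)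
Lemma algebra_homogeneous n (f : op p n.+1) m (g : op p m.+1) :
  C (FinOp g) -> ~ affine_op g -> f 0 = 0 ->
  (forall a, multipliers a -> forall x, f (a *: x) = a * f x) -> C (FinOp f).
Proof.
move=> Cg gNaff f0 fH.
have [q Cq qP] := algebra_conjunction Cg gNaff.
apply: (algebra_interpolation Cq qP) => v w.
have coordC i (c : F) : C (FinOp (fun x : 'rV[F]_n.+1 => c * x ord0 i)).
  by apply: linC => x y; rewrite mxE mulrDr.
have [->|v0] := eqVneq v 0.
  have [->|w0] := eqVneq w 0.
    exists (fun x => 0 * x ord0 ord0); split=> //; by rewrite mul0r f0.
  have /rV0Pn[i wi] := w0.
  exists (fun x => f w / w ord0 i * x ord0 i); split=> //.
    by rewrite mxE mulr0 f0.
  by rewrite divfK.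
have /rV0Pn[i vi] := v0.
pose c := w ord0 i / v ord0 i.
(* c is the only scalar for which w can be c v, as seen on coordinate i. *)
have [wE|] := eqVneq (w - c *: v) 0; last first.
  move=> /rV0Pn[j wj].
  pose d := (f w - c * f v) / (w - c *: v) ord0 j.
  exists (fun x => f v / v ord0 i * x ord0 i +
    (d * x ord0 j - d * v ord0 j / v ord0 i * x ord0 i)); split.
  - by apply: algebra_add => //; exact: algebra_sub.
  - by rewrite !divfK // subrr addr0.
  - have -> : f w = c * f v + d * (w - c *: v) ord0 j.
      by rewrite divfK // addrC subrK.
    by rewrite !mxE /c; field.
move/subr0_eq: wE => wE.
pose l (x : 'rV[F]_n.+1) : F := (v ord0 i)^-1 * x ord0 i.
have Cl : C (FinOp l) by exact: coordC.
have lv : l v = 1 by rewrite /l mulVf.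
have lw : l w = c by rewrite /l mulrC.
have [cH|cNH] := pselect (multipliers c).
  exists (fun x => f v * l x); split; first exact: algebra_scale.
    by rewrite lv mulr1.
  by rewrite lw mulrC wE fH.
move: cNH => /existsNP[k /existsNP[h /not_implyP[Ch /existsNP[y /eqP hy]]]].
rewrite -subr_eq0 in hy.
pose b := (f w - c * f v) / (h (c *: y) - c * h y).
pose u x := h ((l x) *: y).
have Cu : C (FinOp u).
  pose A : 'M[F]_(n.+1, k.+1) :=
    (v ord0 i)^-1 *: \matrix_(j, j') ((j == i)%:R * y ord0 j').
  have -> : u = fun x => h (x *m A).
    apply/funext => x; congr h; apply/rowP => j.
    rewrite !mxE (bigD1 i) //= !mxE eqxx big1 ?addr0 /l => [|j' /negPf ji].
      by rewrite mul1r mulrCA mulrA.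
    by rewrite !mxE ji mul0r !mulr0.
  exact: algebra_mulmx.
exists (fun x => (f v - b * h y) * l x + b * u x); split.
- by apply: algebra_add; exact: algebra_scale.
- by rewrite lv mulr1 /u lv scale1r subrK.
- rewrite lw /u lw.
  have -> : f w = c * f v + b * (h (c *: y) - c * h y).
    by rewrite divfK // addrC subrK.
  by ring.
Qed.

End Closure.

(** * Classification *)

(** Indexing the list by numbers makes the set of algebras the image of an
initial segment under an injective map. *)
Definition algebra_nth (i : nat) : set (finop p) :=
  match i with
  | 0 => ops_with zero_op
  | 1 => ops_with constant_op
  | 2 => ops_with additive_op
  | 3 => ops_with affine_op
  | 4 => ops_with any_op
  | k.+4.+1 => ops_with (homogeneous_op (nth 0%N (divisors (p - 1)) k))
  end.

Lemma algebra_nth_algebra i : linearly_closed_iterative_algebra (algebra_nth i).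
Proof.
case: i => [|[|[|[|[|k]]]]] /=.
- exact: zero_algebra.
- exact: constant_algebra.
- exact: additive_algebra.
- exact: affine_algebra.
- exact: full_algebra.
- exact: homogeneous_algebra.
Qed.

Lemma eq_ops_with (C : set (finop p)) (P : forall n, op p n -> Prop) :
  (forall n (f : op p n.+1), C (FinOp f) <-> P n.+1 f) -> C = ops_with P.
Proof. by move=> CP; apply/seteqP; split=> -[n f] /CP. Qed.

Lemma constant_algebra_cases C : linearly_closed_iterative_algebra C ->
  (forall n (f : op p n.+1), C (FinOp f) -> constant_op f) ->
  C = ops_with zero_op \/ C = ops_with constant_op.
Proof.
move=> algC Ccst.
have [[n [c [Cc c0]]]|C0] :=
  pselect (exists n (c : op p n.+1), C (FinOp c) /\ c 0 != 0).
  right; apply: eq_ops_with => m f; split=> [/Ccst//|fC].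
  have := algebra_scale algC (f 0 / c 0) (algebra_at0 algC m Cc).
  under [X in FinOp X]funext do rewrite divfK //.
  by rewrite (_ : f = fun=> f 0) //; apply/funext.
left; apply: eq_ops_with => m f; split=> [Cf x|f0].
  rewrite Ccst //; apply: contrapT => /eqP fn0.
  by apply: C0; exists m, f.
case: algC.1 => -[[n g] Cg] _ _.
have := algebra_scale algC 0 (algebra_at0 algC m Cg).
under [X in FinOp X]funext do rewrite mul0r.
by rewrite (_ : f = fun=> 0) //; apply/funext.
Qed.

Lemma affine_algebra_cases C : linearly_closed_iterative_algebra C ->
  (forall n (l : op p n.+1), additive_op l -> C (FinOp l)) ->
  (forall n (f : op p n.+1), C (FinOp f) -> affine_op f) ->
  C = ops_with additive_op \/ C = ops_with affine_op.
Proof.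
move=> algC linC Caff.
have [[n [c [Cc c0]]]|C0] :=
  pselect (exists n (c : op p n.+1), C (FinOp c) /\ c 0 != 0).
  right; apply: eq_ops_with => m f; split=> [/Caff//|/linC Cf].
  have := algebra_scale algC (f 0 / c 0) (algebra_at0 algC m Cc).
  move=> /(algebra_add algC Cf).
  by under [X in FinOp X]funext do rewrite divfK // subrK.
left; apply: eq_ops_with => m f; split=> [Cf x y|/linC//].
have f0 : f 0 = 0 by apply: contrapT => /eqP fn0; apply: C0; exists m, f.
by have := Caff _ _ Cf x y; rewrite f0 !subr0.
Qed.

Hypothesis p_prime : prime p.

Lemma nonaffine_algebra_cases C n (g : op p n.+1) :
  linearly_closed_iterative_algebra C ->
  (forall n (l : op p n.+1), additive_op l -> C (FinOp l)) ->
  C (FinOp g) -> ~ affine_op g ->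
  C = ops_with any_op \/
  exists2 t, (t %| p - 1)%N & C = ops_with (homogeneous_op t).
Proof.
move=> algC linC Cg gNaff.
have [[m [c [Cc c0]]]|C0] :=
  pselect (exists n (c : op p n.+1), C (FinOp c) /\ c 0 != 0).
  left; apply: eq_ops_with => k f; split=> // _.
  exact: (algebra_full algC linC _ Cg gNaff Cc c0).
have {}C0 m f : C (@FinOp p m f) -> f 0 = 0.
  by move=> Cf; apply: contrapT => /eqP fn0; apply: C0; exists m, f.
right; have [|a b aH bH m f Cf x|t] := @subgroup_unit_roots F (multipliers C).
- by move=> m f Cf x; rewrite scale1r mul1r.
- by rewrite -scalerA aH // bH // mulrA.
rewrite card_Fp // -subn1 => tp tE; exists t => //.
have t0 : (0 < t)%N by apply: dvdn_gt0 tp; rewrite subn_gt0 prime_gt1.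
have tNH (a : F) : a ^+ t = 1 -> a != 0.
  by apply: contra_eqN => /eqP->; rewrite expr0n gtn_eqF // eq_sym oner_eq0.
apply: eq_ops_with => m f; split=> [Cf|[f0 fH]].
  split=> [|a x at1]; first exact: C0.
  exact: ((tE a (tNH a at1)).2 at1 _ _ Cf).
apply: (algebra_homogeneous algC linC Cg gNaff f0) => a aH x.
have [->|a0] := eqVneq a 0; first by rewrite scale0r mul0r.
by apply: fH; exact/tE.
Qed.

Lemma algebra_nth_surj C : linearly_closed_iterative_algebra C ->
  exists2 i, (i < size (divisors (p - 1)) + 5)%N & algebra_nth i = C.
Proof.
move=> algC.
have [[n [f [Cf fNC]]]|Ccst] := pselect (exists n (f : op p n.+1),
  C (FinOp f) /\ ~ constant_op f); last first.
  have [|->|->] := constant_algebra_cases algC.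
  - by move=> n f Cf; apply: contrapT => fN; apply: Ccst; exists n, f.
  - by exists 0%N; rewrite // addnS.
  - by exists 1%N; rewrite // !addnS.
have linC m (l : op p m.+1) : additive_op l -> C (FinOp l).
  move: fNC => /existsNP[v /eqP fv]; exact: (algebra_additive algC Cf fv).
have [[m [g [Cg gNA]]]|Caff] :=
  pselect (exists n (f : op p n.+1), C (FinOp f) /\ ~ affine_op f); last first.
  have [|->|->] := affine_algebra_cases algC linC.
  - by move=> m g Cg; apply: contrapT => gN; apply: Caff; exists m, g.
  - by exists 2%N; rewrite // !addnS.
  - by exists 3%N; rewrite // !addnS.
have [->|[t tp ->]] := nonaffine_algebra_cases algC linC Cg gNA.
  by exists 4%N; rewrite // !addnS.
have td : t \in divisors (p - 1).
  by rewrite -dvdn_divisors // subn_gt0 prime_gt1.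
exists (index t (divisors (p - 1))).+4.+1.
  by rewrite !addnS addn0 !ltnS index_mem.
by rewrite /= nth_index.
Qed.

(** * Distinctness and counting *)

(** x^(s+1) satisfies f(ax) = a f(x) exactly when a = 0 or a^s = 1; test this
on an element a of order t. *)
Lemma homogeneous_op_dvd s t : (t %| p - 1)%N ->
  ops_with (homogeneous_op s) `<=` ops_with (homogeneous_op t) -> (t %| s)%N.
Proof.
move=> tp st; pose f : op p 1 := fun x => x ord0 ord0 ^+ s.+1.
have [_ fH] : homogeneous_op t f.
  apply: (st (FinOp f)); split=> [|a x as1] /=; rewrite /f mxE.
    by rewrite expr0n.
  by rewrite exprMn exprS as1 mulr1.
have [|a aP] := @exists_element_of_order F t.
  by rewrite card_Fp // -subn1.
have at1 : a ^+ t = 1 by apply: (aP t).2.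
have t0 : (0 < t)%N by apply: dvdn_gt0 tp; rewrite subn_gt0 prime_gt1.
have a0 : a != 0.
  by apply: contra_eqN at1 => /eqP->; rewrite expr0n gtn_eqF // eq_sym oner_eq0.
apply: (aP s).1; apply: (mulfI a0).
have := fH a 1%:M at1.
by rewrite /f !mxE eqxx mulr1 expr1n exprS !mulr1.
Qed.

Lemma homogeneous_op_inj s t : (s %| p - 1)%N -> (t %| p - 1)%N ->
  ops_with (homogeneous_op s) = ops_with (homogeneous_op t) -> s = t.
Proof.
move=> sp tp st; apply/eqP; rewrite eqn_dvd.
by rewrite (homogeneous_op_dvd sp) ?(homogeneous_op_dvd tp) // st.
Qed.

(** The exponent p - 1 makes the second argument invisible to nonzero scalars,
so this operation is homogeneous for every t dividing p - 1, and it is not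
affine. *)
Definition and_op : op p 2 := fun x => x ord0 ord0 * x ord0 ord_max ^+ (p - 1).

Lemma and_op_not_affine : ~ affine_op and_op.
Proof.
have p1 : (0 < p - 1)%N by rewrite subn_gt0 prime_gt1.
move=> /(_ (row2 1 0) (row2 0 1)); rewrite /and_op !mxE /=.
by rewrite !(mul0r, addr0, add0r, subr0, expr0n, gtn_eqF, mulr0, expr1n) //
  mulr1 => /eqP; rewrite oner_eq0.
Qed.

Lemma and_op_homogeneous t : (t %| p - 1)%N -> homogeneous_op t and_op.
Proof.
have p1 : (0 < p - 1)%N by rewrite subn_gt0 prime_gt1.
move=> tp; split=> [|a x at1]; first by rewrite /and_op !mxE mul0r.
rewrite /and_op !mxE exprMn; have /dvdnP[k ->] := tp.
by rewrite [in a ^+ _]mulnC exprM at1 expr1n mul1r mulrA.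
Qed.

Lemma algebra_nth_one i :
  algebra_nth i (FinOp ((fun=> 1) : op p 1)) <-> i \in [:: 1; 3; 4]%N.
Proof.
have n10 : 1 <> 0 :> F by apply/eqP; exact: oner_neq0.
case: i => [|[|[|[|[|k]]]]]; split=> //=.
- by move/(_ 0).
- by move/additive_op0.
- by move=> _ x y; rewrite subrr addr0.
- by case.
Qed.

Lemma algebra_nth_proj i :
  algebra_nth i (FinOp (@proj p 1 ord0)) <-> (1 < i)%N.
Proof.
have n10 : 1 <> 0 :> F by apply/eqP; exact: oner_neq0.
have projD := @additive_proj 1 ord0.
case: i => [|[|[|[|[|k]]]]]; split=> //=.
- by move/(_ (const_mx 1)); rewrite /= /proj mxE.
- by move/(_ (const_mx 1)); rewrite /= /proj !mxE.
- by move=> _ x y; rewrite /= /proj !mxE !subr0.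
- move=> _; split=> [|a x _]; first by rewrite /= /proj mxE.
  by rewrite /= /proj mxE.
Qed.

Lemma algebra_nth_and i : (i < size (divisors (p - 1)) + 5)%N ->
  algebra_nth i (FinOp and_op) <-> (3 < i)%N.
Proof.
have andNA := and_op_not_affine.
case: i => [|[|[|[|[|k]]]]] ltiN; split=> //= andA; try by case: andNA.
- by case: andNA => x y; rewrite !(andA : zero_op and_op) subrr addr0.
- have {}andA : constant_op and_op := andA.
  by case: andNA => x y; rewrite !(andA (_ + _)) !(andA x) !(andA y)
    !subrr addr0.
- by case: andNA => x y;
  rewrite (additive_op0 (andA : additive_op and_op)) !subr0.
- apply: and_op_homogeneous; rewrite dvdn_divisors ?subn_gt0 ?prime_gt1 //.
  by rewrite mem_nth //; move: ltiN; rewrite !addnS addn0 !ltnS.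
Qed.

Lemma algebra_nth_inj :
  {in `I_(size (divisors (p - 1)) + 5)%N &, injective algebra_nth}.
Proof.
move=> i j /set_mem /= iN /set_mem /= jN eq_ij.
have p1 : (0 < p - 1)%N by rewrite subn_gt0 prime_gt1.
have eq1 : (i \in [:: 1; 3; 4]%N) = (j \in [:: 1; 3; 4]%N).
  by apply/idP/idP; rewrite -!algebra_nth_one eq_ij.
have eq2 : (1 < i)%N = (1 < j)%N.
  by apply/idP/idP; rewrite -!algebra_nth_proj eq_ij.
have eq3 : (3 < i)%N = (3 < j)%N.
  by apply/idP/idP; rewrite -!algebra_nth_and // eq_ij.
case: i j iN jN eq_ij eq1 eq2 eq3 =>
  [|[|[|[|[|k]]]]] [|[|[|[|[|l]]]]] //.
rewrite !addnS addn0 !ltnS => kN lN eq_kl _ _ _.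
do 5! congr _.+1; apply/eqP.
rewrite -(nth_uniq 0%N kN lN (divisors_uniq _)); apply/eqP.
by apply: homogeneous_op_inj eq_kl; rewrite dvdn_divisors // mem_nth.
Qed.

End Algebras.

Theorem corollary4p3 (p : nat) (p_prime : prime p) :
  [set C : set (finop p) | linearly_closed_iterative_algebra C]
    #= `I_(size (divisors (p - 1)) + 5).
Proof.
rewrite (_ : [set C | _] =
    algebra_nth (p := p) @` `I_(size (divisors (p - 1)) + 5)).
  exact/inj_card_eq/algebra_nth_inj.
apply/seteqP; split=> [C /(algebra_nth_surj p_prime)[i iN <-]|_ [i _ <-]].
  by exists i.
exact: algebra_nth_algebra.
Qed.
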